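(* Let $n\ge1$ and let $H$ be dense in $\widehat{\mathcal F_n}$. Then $$\mathcal O\big(\mathrm{Spec}^0_\downarrow(H)\big)=\mathcal O_\downarrow\big(\mathrm{Spec}^0_\downarrow(H),\subseteq\big),$$ that is, the Zariski topology on the principal ideal spectrum of $H$ is the topology whose open sets are exactly the sets of principal prime ideals that are decreasing with respect to inclusion.
   Context: Fix $n\ge1$ and symbols $P_1,\dots,P_n$. The partially ordered set $(K_n,\le)$ with valuation map $\mathrm{val}:K_n\to\mathfrak P(\{P_1,\dots,P_n\})$ is the increasing union of finite sets $K_n^d$ ($d\ge 0$) built recursively: $K_n^{-1}=\emptyset$, and $K_n^d\setminus K_n^{d-1}$ consists of exactly one point $w_{\beta,Y}$ for each pair $(\beta,Y)$ such that (i) $Y$ is a decreasing subset of $K_n^{d-1}$ with $Y\not\subseteq K_n^{d-2}$ (for $d=0$ this last condition is void, so $Y=\emptyset$); (ii) $\beta\subseteq\{P_1,\dots,P_n\}$ and $\beta\subseteq\mathrm{val}(w')$ for all $w'\in Y$; (iii) if $Y$ is the decreasing set generated by a single element $w_{\beta',Y'}$, then $\beta\ne\beta'$. One sets $\mathrm{val}(w_{\beta,Y})=\beta$, and $w\le w_{\beta,Y}$ iff $w\in Y$ or $w=w_{\beta,Y}$. $\widehat{\mathcal F_n}:=\mathcal O_\downarrow(K_n,\le)$ is the Heyting algebra of all decreasing subsets of $K_n$ ($\sqcap=\cap$, $\sqcup=\cup$, $a\to b$ = the largest decreasing set contained in $(K_n\setminus a)\cup b$). It carries the metric $\mathrm d(a,b)=2^{-\min\{i\in\mathbb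 N\mid a\cap K_n^i\neq b\cap K_n^i\}}$ ($2^{-\min\emptyset}=0$). ''$H$ is dense in $\widehat{\mathcal F_n}$'' means that $H$ is a Heyting sub-algebra of $\widehat{\mathcal F_n}$ that is dense for this metric; equivalently, all maps $H\to\mathcal O_\downarrow(K_n^d,\le)$, $a\mapsto a\cap K_n^d$, are surjective. A principal ideal of a lattice is a set $(x)_\downarrow=\{y: y\le x\}$ with $x\ne1$. $\mathrm{Spec}^0_\downarrow(H)$ is the set of all principal prime ideals of $H$, with the trace of the Zariski topology; i.e. a basis of open sets is given by the sets $\{\mathfrak i\in\mathrm{Spec}^0_\downarrow(H)\mid a\notin\mathfrak i\}$ for $a\in H$. $\mathcal O(X)$ denotes the lattice of open sets of a topological space $X$, and $\mathcal O_\downarrow(X,\le)$ the lattice of decreasing subsets of a partially ordered set. *)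

(* Defs.v *)
From HB Require Import structures.
From mathcomp Require Import all_boot all_order all_algebra finmap.
From mathcomp Require Import boolp classical_sets reals.
From mathcomp Require Import topology_structure uniform_structure.
From mathcomp Require Import pseudometric_structure metric_structure.

Set Implicit Arguments.
Unset Strict Implicit.
Unset Printing Implicit Defensive.

Import Order.TTheory GRing.Theory Num.Theory.

Local Open Scope classical_set_scope.

Definition decreasing_sets (T : Type) (le : T -> T -> Prop) : set (set T) :=
  [set U | forall x y, le x y -> U y -> U x].

(* The points w_{beta,Y} are hereditarily finite trees: a node carries the set
   beta (of indices of the symbols P_i) and the list of the points of Y. *)
Inductive tree (n : nat) : Type := Node of {set 'I_n} & seq (tree n).

Section TreeChoice.
Variable n : nat.

Fixpoint tree_encode (t : tree n) : GenTree.tree {set 'I_n} :=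
  let: Node b s := t in
  GenTree.Node 0 (GenTree.Leaf b :: map tree_encode s).

Fixpoint tree_decode (g : GenTree.tree {set 'I_n}) : option (tree n) :=
  match g with
  | GenTree.Node _ (GenTree.Leaf b :: s) => Some (Node b (pmap tree_decode s))
  | _ => None
  end.

Lemma tree_encodeK : pcancel tree_encode tree_decode.
Proof.
rewrite /pcancel; fix IH 1 => -[b s] /=; congr (Some (Node b _)).
by elim: s => //= t s IHs; rewrite IH /= IHs.
Qed.

HB.instance Definition _ := Choice.copy (tree n) (pcan_type tree_encodeK).

Definition tree_val (t : tree n) : {set 'I_n} := let: Node b _ := t in b.
Definition tree_below (t : tree n) : seq (tree n) := let: Node _ s := t in s.

Definition tree_le (u t : tree n) : bool := (u \in tree_below t) || (u == t).

(* A value of type {fset _} is determined by its list of elements, so this map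
   is injective in both arguments. *)
Definition point (b : {set 'I_n}) (Y : {fset tree n}) : tree n :=
  Node b (enum_fset Y).

(* Given [cur] = K_n^{d-1}, and [old] = K_n^{d-2} if d > 0 and None if d = 0,
   the pairs (beta, Y) for which K_n^d has a new point w_{beta,Y}. *)
Definition admissible (old : option {fset tree n}) (cur : {fset tree n})
    (b : {set 'I_n}) (Y : {fset tree n}) : Prop :=
  [/\ (Y `<=` cur)%fset /\
        (forall u w, u \in cur -> w \in Y -> tree_le u w -> u \in Y),
      (if old is Some o then ~~ (Y `<=` o)%fset else true),
      (forall w, w \in Y -> b \subset tree_val w) &
      (forall w, w \in cur -> Y = [fset u in cur | tree_le u w]%fset ->
         b != tree_val w)].

(* [stage d] is K_n^{d-1}. *)
Fixpoint stage (d : nat) : {fset tree n} :=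
  match d with
  | 0 => fset0
  | d'.+1 =>
    let old := if d' is d''.+1 then Some (stage d'') else None in
    (stage d' `|`
     [fset point b Y | b in [set: {set 'I_n}]%SET, Y in fpowerset (stage d')
                     & `[< admissible old (stage d') b Y >]])%fset
  end.

End TreeChoice.

Section TreeOrder.
Variable n : nat.
Implicit Types t u v w : tree n.

Lemma stageS d w : reflect
  (w \in stage n d \/ exists b Y, [/\ (Y `<=` stage n d)%fset,
     admissible (if d is d'.+1 then Some (stage n d') else None)
       (stage n d) b Y & w = point b Y])
  (w \in stage n d.+1).
Proof.
rewrite /= in_fsetU; apply: (iffP orP) => -[wd|]; first by left.
- case/imfset2P => b _ [Y]; rewrite !inE /= => /andP[YK /asboolP adm ->].
  by right; exists b, Y; split=> //; rewrite -fpowersetE.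
- by left.
- case=> b [Y [YK adm ->]]; right; apply/imfset2P; exists b; first by rewrite inE.
  by exists Y => //; rewrite !inE /= fpowersetE YK; apply/asboolP.
Qed.

Lemma stage_below d w u : w \in stage n d -> u \in tree_below w -> u \in stage n d.
Proof.
elim: d => [|d IHd]; first by rewrite inE.
case/stageS => [wd uw|[b [Y [YK _ ->]]] uY].
  by apply/stageS; left; exact: IHd uw.
by apply/stageS; left; exact: (fsubsetP YK).
Qed.

Lemma tree_le_refl : reflexive (@tree_le n).
Proof. by move=> t; rewrite /tree_le eqxx orbT. Qed.

Lemma tree_le_trans d u v w : w \in stage n d ->
  tree_le u v -> tree_le v w -> tree_le u w.
Proof.
move=> wd uv /orP[vw|/eqP <- //]; apply/orP; left.
elim: d wd => [|d IHd]; first by rewrite inE.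
case/stageS => [/IHd //|[b [Y [YK [[_ Ydec] _ _ _] wE]]]]; rewrite wE in vw *.
have vK : v \in stage n d by exact: (fsubsetP YK).
apply: (Ydec u v) => //; case/orP: uv => [|/eqP-> //]; exact: stage_below.
Qed.

Fixpoint tree_size t : nat := let: Node _ s := t in (sumn (map tree_size s)).+1.

Lemma tree_size_below u t : u \in tree_below t -> tree_size u < tree_size t.
Proof.
case: t => b s /=; rewrite ltnS; elim: s => //= v s IHs.
rewrite inE => /orP[/eqP->|/IHs le_us]; first exact: leq_addr.
exact: leq_trans le_us (leq_addl _ _).
Qed.

Lemma tree_le_anti : antisymmetric (@tree_le n).
Proof.
move=> u t /andP[/orP[ut|/eqP//] /orP[tu|/eqP//]].
by have := ltn_trans (tree_size_below ut) (tree_size_below tu); rewrite ltnn.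
Qed.

End TreeOrder.

Definition K (n : nat) : Type := {w : tree n | `[< exists d, w \in stage n d >]}.

Fact K_display : Order.disp_t. Proof. by []. Qed.

Section KTheory.
Variable n : nat.

HB.instance Definition _ := SubType.on (K n).
HB.instance Definition _ := Choice.on (K n).

Let le (x y : K n) := tree_le (val x) (val y).

Let le_refl : reflexive le.
Proof. by move=> x; exact: tree_le_refl. Qed.

Let le_anti : antisymmetric le.
Proof. by move=> x y /tree_le_anti/val_inj. Qed.

Let le_trans : transitive le.
Proof. by move=> y x z; have /asboolP[d zd] := valP z; exact: tree_le_trans zd. Qed.

HB.instance Definition _ :=
  Order.Le_isPOrder.Build K_display (K n) le_refl le_anti le_trans.

(* [layer d] is K_n^d, as a subset of K_n. *)
Definition layer (d : nat) : set (K n) := [set x | val x \in stage n d.+1].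

Definition K_val (x : K n) : {set 'I_n} := tree_val (val x).

End KTheory.

Arguments layer : clear implicits.

Section Fhat.
Variable n : nat.

Definition down_sets : set (set (K n)) :=
  decreasing_sets (fun x y : K n => (x <= y)%O).

Definition Fhat : Type := {a : set (K n) | a \in down_sets}.

HB.instance Definition _ := SubType.on Fhat.
HB.instance Definition _ := Choice.on Fhat.

Let P : {pred set (K n)} := fun a => a \in down_sets.

Lemma down_setI : {in P &, forall a b, (a `&` b)%O \in P}.
Proof.
move=> a b /set_mem aD /set_mem bD; apply: mem_set => x y xy [ay b_y].
by split; [exact: aD ay|exact: bD b_y].
Qed.

Lemma down_setU : {in P &, forall a b, (a `|` b)%O \in P}.
Proof.
move=> a b /set_mem aD /set_mem bD; apply: mem_set => x y xy [ay|b_y].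
  by left; exact: aD ay.
by right; exact: bD b_y.
Qed.

Lemma down_set0 : (\bot : set (K n))%O \in P.
Proof. exact: mem_set. Qed.

Lemma down_setT : (\top : set (K n))%O \in P.
Proof. exact: mem_set. Qed.

HB.instance Definition _ :=
  Order.SubChoice_isTBSubLattice.Build set_display (set (K n)) P set_display Fhat
    down_setI down_setU down_set0 down_setT.

Let Fhat_meetUl : @left_distributive Fhat Fhat Order.meet Order.join.
Proof. by move=> a b c; apply: val_inj; exact: setIUl. Qed.

HB.instance Definition _ :=
  Order.Lattice_Meet_isDistrLattice.Build set_display Fhat Fhat_meetUl.

Definition himp_set (a b : Fhat) : set (K n) :=
  \bigcup_(c in [set c | down_sets c /\ c `<=` ~` val a `|` val b]) c.

Lemma himp_subproof a b : himp_set a b \in down_sets.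
Proof.
by apply: mem_set => x y xy [c [cD cab] cy]; exists c => //; exact: cD cy.
Qed.

Definition himp (a b : Fhat) : Fhat := exist _ (himp_set a b) (himp_subproof a b).

Lemma leFhat (a b : Fhat) : (a <= b)%O = (val a `<=` val b) :> Prop.
Proof. by rewrite -subsetEset. Qed.

Lemma himpP (a b c : Fhat) : (c <= himp a b)%O = (c `&` a <= b)%O.
Proof.
apply/idP/idP; rewrite !leFhat => h x.
  case=> cx ax; have [e [_ eab] ex] := h x cx.
  by case: (eab x ex).
move=> cx; exists (val c) => //; split; first exact: set_mem (valP c).
move=> y cy; have [ay|ay] := pselect (val a y); [right|by left].
exact: h.
Qed.

End Fhat.

(* A copy of Fhat n for the metric; [R] is the field in which distances are
   taken. *)
Definition Fhat_metric (R : realType) (n : nat) : Type := Fhat n.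

Section Metric.
Variables (R : realType) (n : nat).
Local Open Scope ring_scope.

Definition differ_at (a b : Fhat n) : pred nat :=
  fun i => `[< val a `&` layer n i <> val b `&` layer n i >].

Definition dist (a b : Fhat n) : R :=
  if pselect (exists i, differ_at a b i) is left e then 2 ^- ex_minn e else 0.

Lemma dist_gt (a b : Fhat n) i : differ_at a b i -> 2 ^- i <= dist a b.
Proof.
rewrite /dist => ab; case: pselect => [e|[]]; last by exists i.
case: ex_minnP => m _ /(_ i ab) le_mi.
by rewrite lef_pV2 ?posrE ?exprn_gt0// ler_weXn2l// ler1n.
Qed.

Lemma dist_le (a b : Fhat n) (e : R) : 0 <= e ->
  (forall i, differ_at a b i -> 2 ^- i <= e) -> dist a b <= e.
Proof.
by rewrite /dist => e0 h; case: pselect => // ?; case: ex_minnP => m /h.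
Qed.

Lemma dist_ge0 (a b : Fhat n) : 0 <= dist a b.
Proof.
rewrite /dist; case: pselect => // ?.
by rewrite invr_ge0 exprn_ge0.
Qed.

Lemma distxx (a : Fhat n) : dist a a = 0.
Proof.
rewrite /dist; case: pselect => // e; exfalso.
by case: e => i /asboolP.
Qed.

Lemma dist_positivity (a b : Fhat n) : dist a b = 0 -> a = b.
Proof.
move=> ab0; apply: val_inj; rewrite predeqE => x.
have /asboolP[d xd] := valP x.
have xl : layer n d x by apply/stageS; left.
have : ~~ differ_at a b d.
  apply/negP => /dist_gt; rewrite ab0 leNgt => /negP; apply.
  by rewrite invr_gt0 exprn_gt0.
move=> /asboolPn/contrapT/(congr1 (@^~ x)) eqx.
have [abx bax] : (val a `&` layer n d) x <-> (val b `&` layer n d) x.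
  by rewrite eqx.
by split=> h; [case: abx | case: bax].
Qed.

Lemma dist_sym (a b : Fhat n) : dist a b = dist b a.
Proof.
suff h (x y : Fhat n) : dist x y <= dist y x by apply/eqP; rewrite eq_le !h.
apply: dist_le (dist_ge0 _ _) _ => i /asboolP xy; apply: dist_gt.
by apply/asboolP => yx; apply: xy.
Qed.

Lemma dist_ultra (b a c : Fhat n) : dist a c <= Num.max (dist a b) (dist b c).
Proof.
apply: dist_le => [|i /asboolP ac]; first by rewrite le_max dist_ge0.
rewrite le_max; have [ab|/asboolPn/contrapT ab] := boolP (differ_at a b i).
  by rewrite (dist_gt ab).
by rewrite (@dist_gt b c i) ?orbT//; apply/asboolP => bc; apply: ac; rewrite ab.
Qed.

Lemma dist_triangle (b a c : Fhat n) : dist a c <= dist a b + dist b c.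
Proof.
by rewrite (le_trans (dist_ultra b a c))// ge_max lerDl lerDr !dist_ge0.
Qed.

HB.instance Definition _ := Choice.on (Fhat_metric R n).
HB.instance Definition _ :=
  isMetric.Build R (Fhat_metric R n) distxx dist_positivity dist_sym dist_triangle.

End Metric.

Record heyting_subalgebra (n : nat) := HeytingSubalgebra {
  subalgebra_set :> set (Fhat n);
  subalgebra_bot : subalgebra_set \bot%O;
  subalgebra_top : subalgebra_set \top%O;
  subalgebra_meet : forall a b, subalgebra_set a -> subalgebra_set b ->
    subalgebra_set (a `&` b)%O;
  subalgebra_join : forall a b, subalgebra_set a -> subalgebra_set b ->
    subalgebra_set (a `|` b)%O;
  subalgebra_himp : forall a b, subalgebra_set a -> subalgebra_set b ->
    subalgebra_set (himp a b)
}.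

Definition dense_in_Fhat (R : realType) (n : nat) (H : heyting_subalgebra n) :=
  dense (H : set (Fhat_metric R n)).

Section SubalgebraLattice.
Variables (n : nat) (H : heyting_subalgebra n).

(* The Heyting sub-algebra H as a bounded distributive lattice of its own. *)
Definition subalgebra_type : Type := {a : Fhat n | a \in (H : set (Fhat n))}.
HB.instance Definition _ := SubType.on subalgebra_type.
HB.instance Definition _ := Choice.on subalgebra_type.

Let P : {pred Fhat n} := fun a => a \in (H : set (Fhat n)).

Lemma subalgebra_meetP : {in P &, forall a b, (a `&` b)%O \in P}.
Proof.
by move=> a b /set_mem aH /set_mem bH; apply/mem_set/subalgebra_meet.
Qed.

Lemma subalgebra_joinP : {in P &, forall a b, (a `|` b)%O \in P}.
Proof.
by move=> a b /set_mem aH /set_mem bH; apply/mem_set/subalgebra_join.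
Qed.

Lemma subalgebra_botP : \bot%O \in P.
Proof. exact/mem_set/subalgebra_bot. Qed.

Lemma subalgebra_topP : \top%O \in P.
Proof. exact/mem_set/subalgebra_top. Qed.

HB.instance Definition _ :=
  Order.SubChoice_isTBSubLattice.Build set_display (Fhat n) P set_display
    subalgebra_type
    subalgebra_meetP subalgebra_joinP subalgebra_botP subalgebra_topP.

Let subalgebra_meetUl :
  @left_distributive subalgebra_type subalgebra_type Order.meet Order.join.
Proof.
move=> a b c; apply: val_inj.
exact: (@meetUl _ (Fhat n) (val a) (val b) (val c)).
Qed.

HB.instance Definition _ :=
  Order.Lattice_Meet_isDistrLattice.Build set_display subalgebra_type
    subalgebra_meetUl.

End SubalgebraLattice.

Section Spectrum.
Context {d : Order.disp_t} (L : tbDistrLatticeType d).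
Local Open Scope order_scope.

Definition lattice_ideal (I : set L) : Prop :=
  [/\ I \bot,
      (forall x y, I x -> I y -> I (x `|` y)) &
      (forall x y, x <= y -> I y -> I x)].

Definition lattice_prime_ideal (I : set L) : Prop :=
  [/\ lattice_ideal I, ~ I \top &
      (forall x y, I (x `&` y) -> I x \/ I y)].

Definition lattice_principal_ideal (I : set L) : Prop :=
  exists2 x : L, x != \top & I = [set y | y <= x].

Definition Spec0 : Type :=
  {I : set L | I \in [set J | lattice_principal_ideal J /\ lattice_prime_ideal J]}.
HB.instance Definition _ := SubType.on Spec0.
HB.instance Definition _ := Choice.on Spec0.

Definition Spec0_base (a : L) : set Spec0 := [set I | ~ val I a].

Definition Spec0_open : set (set Spec0) :=
  [set (\bigcup_(a in A) Spec0_base a)%classic | A in [set: set L]%classic].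

Lemma Spec0_base_top : Spec0_base \top = [set: Spec0]%classic.
Proof. by rewrite predeqE => I; split=> // _; have /set_mem[_ []] := valP I. Qed.

Lemma Spec0_base_meet a b :
  Spec0_base (a `&` b) = (Spec0_base a `&` Spec0_base b)%classic.
Proof.
rewrite predeqE => I; have /set_mem[_ [[_ _ Idec] _ Ipr]] := valP I.
split=> [Iab|[Ia Ib] /Ipr[]//].
by split=> h; apply: Iab; apply: (Idec _ _ _ h); rewrite ?leIl ?leIr.
Qed.

Lemma Spec0_openT : Spec0_open [set: Spec0]%classic.
Proof. by exists [set \top]%classic => //; rewrite bigcup_set1 Spec0_base_top. Qed.

Lemma Spec0_openI (U V : set Spec0) :
  Spec0_open U -> Spec0_open V -> Spec0_open (U `&` V)%classic.
Proof.
move=> [A _ <-] [B _ <-].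
exists [set c | exists a b, [/\ A a, B b & c = (a `&` b)%O]]%classic => //.
rewrite predeqE => I; split=> [[_ [a [b [Aa Bb ->]]]]|[[a Aa Ia] [b Bb Ib]]].
  by rewrite Spec0_base_meet => -[Ia Ib]; split; [exists a|exists b].
by exists (a `&` b); [exists a, b|rewrite Spec0_base_meet].
Qed.

Lemma Spec0_open_bigU (J : Type) (f : J -> set Spec0) :
  (forall j, Spec0_open (f j)) -> Spec0_open (\bigcup_j f j)%classic.
Proof.
move=> fop; exists [set a | exists j, Spec0_base a `<=` f j]%classic => //.
rewrite predeqE => I; split=> [[a [j aj] Ia]|[j _]]; first by exists j => //; exact: aj.
have [A _ fE] := fop j; rewrite -fE => -[a Aa Ia].
by exists a => //; exists j; rewrite -fE => I' I'a; exists a.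
Qed.

(* The trace of the Zariski topology, with the sets Spec0_base a as a basis. *)
HB.instance Definition _ :=
  isOpenTopological.Build Spec0 Spec0_openT Spec0_openI Spec0_open_bigU.

End Spectrum.

(* Main.v *)
Require Import Defs.
From mathcomp Require Import all_boot all_order all_algebra.
From mathcomp Require Import finmap.
From mathcomp Require Import boolp classical_sets reals topology_structure.
From mathcomp Require Import uniform_structure pseudometric_structure.
From mathcomp Require Import metric_structure.

(** A point of rank d+1 in K_n lies above a point of rank d, so a decreasing
    set with no point of rank d+1 has no point of any larger rank.  Hence every
    finite principal decreasing set is isolated in the metric and belongs to
    every dense H.  If x generates a prime ideal of H and w is minimal outside
    x, then a = {v | v <= w} lies in H, is not below x, and a -> x is below x by
    primality; any y of H with a not below y omits w, so that y is below a -> x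
    and thus below x.  The Zariski open set given by a is therefore exactly the
    set of principal prime ideals contained in the ideal of x. *)

Import Order.TTheory GRing.Theory Num.Theory.

Local Open Scope classical_set_scope.

Lemma stage_leq (n i j : nat) (w : tree n) :
  (i <= j)%N -> w \in stage n i -> w \in stage n j.
Proof.
move=> /subnK <-; elim: (j - i)%N => [//|k IHk] wi.
by rewrite addSn; apply/stageS; left; exact: IHk.
Qed.

Lemma down_setP (n : nat) (a : Fhat n) (x y : K n) :
  (x <= y)%O -> val a y -> val a x.
Proof. by move=> xy; have /set_mem := valP a; apply. Qed.

(** By induction on the stage: a point new at stage [p.+2] with [k <= p] lies above some [u] outside
    stage [p]. The induction hypothesis puts [u] in stage [k], a contradiction. *)
Lemma down_set_stage (n k : nat) (a : Fhat n) :
  (forall x, val a x -> val x \in stage n k.+1 -> val x \in stage n k) ->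
  forall x, val a x -> val x \in stage n k.
Proof.
move=> gap x; have /asboolP[m] := valP x.
elim: m x => [|m IHm] x; first by rewrite inE.
move=> xm ax; case/stageS: (xm) => [xm'|[b [Y [YK adm xE]]]]; first exact: IHm.
have [km|mk] := ltnP k m; last by apply: gap => //; exact: stage_leq xm.
case: m km IHm xm YK adm => // p kp IHm xm YK [_ /fsubsetPn[u uY up] _ _].
have up1 : u \in stage n p.+1 by exact: (fsubsetP YK).
have uK : `[< exists d, u \in stage n d >] by apply/asboolP; exists p.+1.
pose v : K n := exist _ u uK.
have vx : (v <= x)%O by rewrite /Order.le/= /tree_le xE uY.
have := stage_leq _ _ _ _ (kp : (k <= p)%N)
  (IHm v up1 (down_setP _ _ _ _ vx ax)).
by rewrite (negPf up).
Qed.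

Lemma principal_down_subproof (n : nat) (w : K n) :
  [set v : K n | (v <= w)%O] \in @down_sets n.
Proof. by apply/mem_set => x y /= xy; exact: le_trans. Qed.

Definition principal_down (n : nat) (w : K n) : Fhat n :=
  exist (fun a : set (K n) => a \in @down_sets n) _
    (principal_down_subproof n w).

Lemma stage_le (n k : nat) (v w : K n) :
  (v <= w)%O -> val w \in stage n k -> val v \in stage n k.
Proof. by move=> /orP[vw wk|/eqP->//]; exact: stage_below vw. Qed.

(** Disagreement on layer [k] forces distance at least [2 ^- k], so the open ball of that radius
    suffices. *)
Lemma dense_approx (R : realType) (n : nat) (H : heyting_subalgebra n) :
  dense_in_Fhat R H -> forall (c : Fhat n) (k : nat),
  exists2 b, subalgebra_set H b & val c `&` layer n k = val b `&` layer n k.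
Proof.
move=> Hd c k; pose e : R := (2 ^- k)%R.
have e0 : (0 < e)%R by rewrite invr_gt0 exprn_gt0.
have [||b [bO Hb]] := Hd (interior (ball (c : Fhat_metric R n) e)).
- by exists c; exact: nbhsx_ballx.
- exact: open_interior.
exists b => //; apply: contrapT => cb.
have := interior_subset bO; rewrite ballEmdist /= ltNge.
by move=> /negP; apply; apply: dist_gt; apply/asboolP.
Qed.

Lemma dense_principal_down (R : realType) (n : nat) (H : heyting_subalgebra n) :
  dense_in_Fhat R H -> forall w, subalgebra_set H (principal_down n w).
Proof.
move=> Hd w; have /asboolP[k wk] := valP w.
(* Layer [k] is stage [k.+1], one stage beyond the one known to contain [w]. Agreement there shows
   that [b] gains no point from stage [k] to [k.+1], hence none later. *)
have [b Hb bE] := dense_approx _ _ _ Hd (principal_down n w) k.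
have eqb x : val x \in stage n k.+1 -> val b x <-> (x <= w)%O.
  move=> xk; have := congr1 (@^~ x) bE; rewrite /setI /= => E.
  by split=> h; [have [] : (x <= w)%O /\ layer n k x by rewrite E
                |have [] : val b x /\ layer n k x by rewrite -E].
have bk : forall x, val b x -> val x \in stage n k.
  apply: down_set_stage => x bx xk.
  by apply: stage_le wk; apply/eqb.
suff -> : principal_down n w = b by [].
apply: val_inj; rewrite predeqE => x; split=> /= [xw|bx].
  by apply/eqb => //; apply: stage_leq (stage_le _ _ _ _ xw wk).
by apply/eqb => //; apply: stage_leq (bk _ bx).
Qed.

(** The order is well-founded because [tree_size] is strictly monotone; a point of least size
    outside [a] works. *)
Lemma exists_minimal_notin (n : nat) (a : Fhat n) : a != \top%O ->
  exists w, ~ val a w /\ forall v, (v < w)%O -> val a v.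
Proof.
move=> aT; pose P m := `[< exists2 w, ~ val a w & tree_size (val w) = m >].
have exP : exists m, P m.
  apply: contrapT => noP; case/eqP: aT; apply: val_inj; rewrite predeqE => w.
  split=> // _; apply: contrapT => aw; apply: noP.
  by exists (tree_size (val w)); apply/asboolP; exists w.
case: (ex_minnP exP) => m /asboolP[w aw <-] min_w; exists w; split=> // v vw.
apply: contrapT => av; have /min_w : P (tree_size (val v)).
  by apply/asboolP; exists v.
move: vw; rewrite lt_neqAle => /andP[vw /orP[/tree_size_below|/eqP/val_inj]].
  by rewrite ltnNge => /negP.
by move/eqP; rewrite (negPf vw).
Qed.

Lemma Spec0_open_decreasing {d : Order.disp_t} (L : tbDistrLatticeType d)
    (U : set (Spec0 L)) :
  open U -> decreasing_sets (fun i j : Spec0 L => val i `<=` val j) U.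
Proof. by case=> A _ <- i j ij [a Aa ja]; exists a => // /ij. Qed.

(** The separating [a] gives each [i] in [U] a basic neighbourhood whose members are all contained
    in [i], hence in [U]. *)
Lemma decreasing_Spec0_open {d : Order.disp_t} (L : tbDistrLatticeType d) :
  (forall i : Spec0 L, exists2 a, ~ val i a &
     forall j : Spec0 L, ~ val j a -> val j `<=` val i) ->
  forall U, decreasing_sets (fun i j : Spec0 L => val i `<=` val j) U -> open U.
Proof.
move=> sep U Udec; exists [set a | Spec0_base a `<=` U] => //.
rewrite predeqE => i; split=> [[a aU ia]|Ui]; first exact: aU.
have [a ia aP] := sep i; exists a => // j ja.
exact: Udec (aP _ ja) Ui.
Qed.

Lemma dense_Spec0_separation (R : realType) (n : nat)
    (H : heyting_subalgebra n) : dense_in_Fhat R H ->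
  forall i : Spec0 (subalgebra_type H), exists2 a, ~ val i a &
    forall j : Spec0 (subalgebra_type H), ~ val j a -> val j `<=` val i.
Proof.
move=> Hd i; have /set_mem[[x xT iE] [_ _ ipr]] := valP i.
have leH (u v : subalgebra_type H) : (u <= v)%O = (val u <= val v)%O by [].
have [|w [xw wmin]] := exists_minimal_notin _ (val x); first by [].
have aH := mem_set (dense_principal_down _ _ _ Hd w).
pose a : subalgebra_type H :=
  exist (fun c : Fhat n => c \in (H : set (Fhat n))) _ aH.
have hH := mem_set (subalgebra_himp (set_mem aH) (set_mem (valP x))).
pose h : subalgebra_type H :=
  exist (fun c : Fhat n => c \in (H : set (Fhat n))) _ hH.
have ia : ~ val i a by rewrite iE /= leH leFhat => /(_ w (lexx w)).
(* Here [h] is [a -> x]: its meet with [a] is below [x], and [a] is not in the prime ideal [i]. *)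
have ih : val i h.
  have [|//|//] := ipr h a; rewrite iE /= leH.
  by rewrite -[(_ <= _)%O]himpP.
exists a => // j ja z jz.
have /set_mem[_ [[_ _ jdec] _ _]] := valP j.
have zw : ~ val (val z) w.
  move=> zw; apply: ja; apply: jdec jz; rewrite leH leFhat => v /= vw.
  exact: down_setP vw zw.
have /set_mem[_ [[_ _ idec] _ _]] := valP i.
(* By adjunction, [z <= h] means that the points of [z] below [w] lie in [x]. They differ from [w],
   so minimality of [w] applies. *)
apply: idec ih; rewrite leH /= himpP leFhat => v [zv /= vw].
apply: wmin; rewrite lt_neqAle vw andbT.
by apply/eqP => vE; apply: zw; rewrite -vE.
Qed.

Theorem proposition5p5 (R : realType) (n : nat) (n_ge1 : (1 <= n)%N)
    (H : heyting_subalgebra n) (H_dense : dense_in_Fhat R H) :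
  (open : set (set (Spec0 (subalgebra_type H)))) =
  decreasing_sets
    (fun i j : Spec0 (subalgebra_type H) => val i `<=` val j).
Proof.
rewrite predeqE => U; split; first exact: Spec0_open_decreasing.
exact: decreasing_Spec0_open (dense_Spec0_separation _ _ _ H_dense) _.
Qed.
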